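(* Consider $N\ge2$ heterogeneous agents $x_i(k+1)=A_ix_i(k)+B_iu_i(k)$, $y_i(k)=C_ix_i(k)$, with $x_i\in\mathbb{R}^{n_i}$, $u_i\in\mathbb{R}^{m_i}$, $y_i\in\mathbb{R}^p$, and local (introspective) measurement $z_i(k)=C_i^m x_i(k)$, where for each $i$: $(A_i,B_i)$ is stabilizable, $(C_i,A_i)$ is detectable, $(C_i,A_i,B_i)$ is right-invertible, and $(C_i^m,A_i)$ is detectable. Let $(C,A,B)$ be a triple with $\operatorname{rank}C=p$, invertible of uniform rank $n_q\ge\bar n_d$ (the maximal order of infinite zeros of the $(C_i,A_i,B_i)$), without invariant zeros, and with all eigenvalues of $A$ in the closed unit disc. Suppose that for each $i$ a pre-compensator $\xi_i(k+1)=A_{i,h}\xi_i(k)+B_{i,h}z_i(k)+E_{i,h}v_i(k)$, $u_i(k)=C_{i,h}\xi_i(k)+D_{i,h}v_i(k)$ is given such that the interconnection with agent $i$ can be written as $\bar x_i(k+1)=A\bar x_i(k)+B(v_i(k)+d_i(k))$, $y_i(k)=C\bar x_i(k)$, where $\omega_i(k+1)=A_{i,s}\omega_i(k)$, $d_i(k)=C_{i,s}\omega_i(k)$ with $A_{i,s}$ Schur stable. Let $K$, $H$ be such that $A-BK$ and $A-HC$ are Schur stable, and apply to each agent the protocol $$\begin{aligned}\xi_i(k+1)&=A_{i,h}\xi_i(k)+B_{i,h}z_i(k)-E_{i,h}K\eta_i(k),\\ \hat x_i(k+1)&=A\hat x_i(k)-BK\hat\zeta_i(k)+H(\zeta_i(k)-C\hat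 x_i(k)),\\ \eta_i(k+1)&=(A-BK)\eta_i(k)+A\hat x_i(k)-A\hat\zeta_i(k),\\ u_i(k)&=C_{i,h}\xi_i(k)-D_{i,h}K\eta_i(k),\end{aligned}$$ with $\zeta_i(k)=\sum_{j}d_{ij}(y_i(k)-y_j(k))$ and $\hat\zeta_i(k)=\sum_j d_{ij}(\eta_i(k)-\eta_j(k))$. Then for every $N$, every weighted directed graph on $N$ nodes containing a directed spanning tree, and all initial conditions, output synchronization holds: $\lim_{k\to\infty}(y_i(k)-y_j(k))=0$ for all $i,j$.
   Context: The network is a weighted directed graph with adjacency matrix $[a_{ij}]$, $a_{ij}\ge0$, $a_{ii}=0$ ($a_{ij}>0$ means an edge from $j$ to $i$); weighted in-degree $d_{in}(i)=\sum_j a_{ij}$; $d_{ij}=a_{ij}/(1+d_{in}(i))$ for $j\ne i$, $d_{ii}=1/(1+d_{in}(i))$. Schur stable means all eigenvalues in the open unit disc. Right-invertibility of $(C_i,A_i,B_i)$ means every reference output can be produced by suitable initial condition and input. A directed spanning tree is a subgraph containing all nodes in which every node except one root has exactly one parent. *)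

(* Defs.v *)
From mathcomp Require Import all_boot all_order all_algebra all_reals.
From mathcomp Require Export complex.
Set Implicit Arguments. Unset Strict Implicit. Unset Printing Implicit Defensive.
Import Order.TTheory GRing.Theory Num.Theory ComplexField.
Local Open Scope ring_scope.

Section Defs.
Variable R : realType.

Definition cmx {m n} (M : 'M[R]_(m, n)) : 'M[R[i]]_(m, n) :=
  map_mx (fun x : R => (x%:C)%C) M.

Definition schur_stable {n} (A : 'M[R]_n) : Prop :=
  forall l : R[i], eigenvalue (cmx A) l -> `|l| < 1.

Definition eig_closed_disc {n} (A : 'M[R]_n) : Prop :=
  forall l : R[i], eigenvalue (cmx A) l -> `|l| <= 1.

Definition stabilizable {n m} (A : 'M[R]_n) (B : 'M[R]_(n, m)) : Prop :=
  exists F : 'M[R]_(m, n), schur_stable (A + B *m F).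

Definition detectable {n p} (C : 'M[R]_(p, n)) (A : 'M[R]_n) : Prop :=
  exists L : 'M[R]_(n, p), schur_stable (A + L *m C).

Definition right_invertible {n m p} (C : 'M[R]_(p, n)) (A : 'M[R]_n)
    (B : 'M[R]_(n, m)) : Prop :=
  forall yr : nat -> 'cV[R]_p,
    exists (x : nat -> 'cV[R]_n) (u : nat -> 'cV[R]_m),
      (forall k, x k.+1 = A *m x k + B *m u k) /\ (forall k, C *m x k = yr k).

Definition left_invertible {n m p} (C : 'M[R]_(p, n)) (A : 'M[R]_n)
    (B : 'M[R]_(n, m)) : Prop :=
  forall (x : nat -> 'cV[R]_n) (u : nat -> 'cV[R]_m),
    x 0%N = 0 -> (forall k, x k.+1 = A *m x k + B *m u k) ->
    (forall k, C *m x k = 0) -> forall k, u k = 0.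

Definition invertible {n m p} (C : 'M[R]_(p, n)) (A : 'M[R]_n)
    (B : 'M[R]_(n, m)) : Prop :=
  left_invertible C A B /\ right_invertible C A B.

Definition uniform_rank {n p} (C : 'M[R]_(p, n)) (A : 'M[R]_n)
    (B : 'M[R]_(n, p)) (nq : nat) : Prop :=
  (0 < nq)%N /\ (forall i, (i < nq.-1)%N -> C *m A ^+ i *m B = 0) /\
  C *m A ^+ nq.-1 *m B \in unitmx.

Definition rosenbrock {n m p} (C : 'M[R]_(p, n)) (A : 'M[R]_n)
    (B : 'M[R]_(n, m)) (l : R[i]) : 'M[R[i]]_(n + p, n + m) :=
  block_mx (cmx A - l%:M) (- cmx B) (cmx C) 0.

(* l is an invariant zero: the rank of the Rosenbrock matrix drops below
   its normal rank (the maximal rank over all complex points) *)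
Definition invariant_zero {n m p} (C : 'M[R]_(p, n)) (A : 'M[R]_n)
    (B : 'M[R]_(n, m)) (l : R[i]) : Prop :=
  exists mu : R[i], (\rank (rosenbrock C A B l) < \rank (rosenbrock C A B mu))%N.

Definition no_invariant_zeros {n m p} (C : 'M[R]_(p, n)) (A : 'M[R]_n)
    (B : 'M[R]_(n, m)) : Prop :=
  forall l : R[i], ~ invariant_zero C A B l.

Definition markov_toeplitz {n m p} (C : 'M[R]_(p, n)) (A : 'M[R]_n)
    (B : 'M[R]_(n, m)) (k : nat) :=
  \mxblock_(a < k, b < k)
     (if (b <= a)%N then C *m A ^+ (a - b) *m B else (0 : 'M[R]_(p, m))).

Definition toeplitz_rank {n m p} (C : 'M[R]_(p, n)) (A : 'M[R]_n)
    (B : 'M[R]_(n, m)) (k : nat) : nat := \rank (markov_toeplitz C A B k).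

Definition n_inf_zeros_le {n m p} (C : 'M[R]_(p, n)) (A : 'M[R]_n)
    (B : 'M[R]_(n, m)) (k : nat) : nat :=
  (toeplitz_rank C A B k - toeplitz_rank C A B k.-1)%N.

Definition max_inf_zero_order_le {n m p} (C : 'M[R]_(p, n)) (A : 'M[R]_n)
    (B : 'M[R]_(n, m)) (d : nat) : Prop :=
  forall k, (0 < d <= k)%N -> n_inf_zeros_le C A B k.+1 = n_inf_zeros_le C A B k.

(* weighted digraph: a i j > 0 means an edge from j to i *)
Definition adjacency {N} (a : 'M[R]_N) : Prop :=
  (forall i j, 0 <= a i j) /\ (forall i, a i i = 0).

Definition has_spanning_tree {N} (a : 'M[R]_N) : Prop :=
  exists (r : 'I_N) (par : 'I_N -> 'I_N),
    (forall i, i != r -> 0 < a i (par i)) /\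
    (forall i, exists k, iter k par i = r).

Definition in_degree {N} (a : 'M[R]_N) (i : 'I_N) : R := \sum_j a i j.

Definition dcoef {N} (a : 'M[R]_N) (i j : 'I_N) : R :=
  if i == j then 1 / (1 + in_degree a i) else a i j / (1 + in_degree a i).

Definition tends_to_zero {p} (f : nat -> 'cV[R]_p) : Prop :=
  forall eps : R, 0 < eps -> exists K : nat, forall k, (K <= k)%N ->
    forall l, `|f k l 0| < eps.

End Defs.

(* Main.v *)
(* Put delta_i = xbar_i - eta_i.  The observer error
   e_i = sum_j d_ij (xbar_i - xbar_j) - xhat_i obeys a Schur stable recursion
   driven by the vanishing disturbances, so it vanishes, and
   delta_i' = A sum_j d_ij delta_j + (vanishing terms).  The matrix (d_ij) is row
   stochastic with positive diagonal, and the spanning tree gives one of its powers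
   a positive column, so this power strictly contracts the spread of a vector.
   Since A has its spectrum in the closed disc, the delta_i synchronize; then
   eta_i' = (A - B K) eta_i + (vanishing terms), so eta_i vanishes and the
   xbar_i = delta_i + eta_i synchronize.

   The spectral hypotheses enter through X' = M X E + f: Cayley-Hamilton allows
   removing one eigenvalue l of M at a time, which reduces the recursion to
   y' = l y E + f for a single row y.  Schur stability is the case E = 1,
   |l| < 1; synchronization is the case where E is the transpose of (d_ij) and
   |l| <= 1, measured by the spread.  No Kronecker products and no growth
   estimates on the powers of A are needed. *)
Require Import Defs.
From mathcomp Require Import all_boot all_order all_algebra all_reals.
From mathcomp Require Import ring lra.
Set Implicit Arguments. Unset Strict Implicit. Unset Printing Implicit Defensive.
Import Order.TTheory GRing.Theory Num.Theory.
Local Open Scope ring_scope.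
Import Normc.

(* Only applied to nonnegative sequences, for which it means convergence to 0. *)
Definition limsup_le0 (R : realType) (s : nat -> R) : Prop :=
  forall eps : R, 0 < eps -> exists K : nat, forall k, (K <= k)%N -> s k < eps.

(** * Vanishing real sequences and perturbed contractions *)

Section LimsupLe0.
Variable R : realType.
Implicit Types s t : nat -> R.

Lemma limsup_le0_le s t :
  (forall k, s k <= t k) -> limsup_le0 t -> limsup_le0 s.
Proof.
move=> st ht e e0; have [K HK] := ht e e0.
by exists K => k /HK; apply: le_lt_trans.
Qed.

Lemma limsup_le0_cst0 : limsup_le0 (fun=> 0 : R).
Proof. by move=> e e0; exists 0%N. Qed.

Lemma limsup_le0D s t :
  limsup_le0 s -> limsup_le0 t -> limsup_le0 (fun k => s k + t k).
Proof.
move=> hs ht e e0; have e2 : 0 < e / 2 by rewrite divr_gt0.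
have [K1 H1] := hs _ e2; have [K2 H2] := ht _ e2.
exists (maxn K1 K2) => k; rewrite geq_max => /andP[/H1 ? /H2 ?]; lra.
Qed.

Lemma limsup_le0_sum (I : finType) (s : I -> nat -> R) :
  (forall i, limsup_le0 (s i)) -> limsup_le0 (fun k => \sum_i s i k).
Proof.
move=> hs; elim: (index_enum I) => [|i r IH].
  by apply: limsup_le0_le limsup_le0_cst0 => k; rewrite big_nil.
apply: limsup_le0_le (limsup_le0D (hs i) IH) => k.
by rewrite big_cons.
Qed.

Lemma limsup_le0Z (c : R) s :
  0 <= c -> limsup_le0 s -> limsup_le0 (fun k => c * s k).
Proof.
rewrite le_eqVlt => /predU1P[<-|c0] hs.
  by apply: limsup_le0_le limsup_le0_cst0 => k; rewrite mul0r.
move=> e e0; have [K HK] := hs (e / c) (divr_gt0 e0 c0).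
by exists K => k /HK; rewrite ltr_pdivlMr // mulrC.
Qed.

Lemma limsup_le0_shift (t : nat) s :
  limsup_le0 s -> limsup_le0 (fun k => s (k + t)%N).
Proof.
move=> hs e e0; have [K HK] := hs e e0.
by exists K => k Kk; apply: HK; rewrite (leq_trans Kk) ?leq_addr.
Qed.

Lemma exists_expr_lt (g e : R) : 0 <= g -> g < 1 -> 0 < e -> exists n, g ^+ n < e.
Proof.
move=> g0 g1 e0.
(* A Bernoulli-type bound: [g ^+ n] is at most [1 / (1 + n (1 - g))], which the Archimedean property
   makes small. *)
have key n : (1 + n%:R * (1 - g)) * g ^+ n <= 1.
  elim: n => [|n IH]; first by rewrite mul0r addr0 mulr1.
  apply: le_trans IH; rewrite exprS mulrA ler_wpM2r ?exprn_ge0 //.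
  rewrite -natr1; have : 0 <= n%:R :> R by [].
  move=> n0; have : 0 <= (n%:R + 1) * (1 - g) ^+ 2.
    by rewrite mulr_ge0 ?sqr_ge0 // addr_ge0.
  rewrite expr2; lra.
have h0 : 0 < e * (1 - g) by rewrite mulr_gt0 // subr_gt0.
have [n Hn] : exists n : nat, (e * (1 - g))^-1 < n%:R.
  exists (Num.bound (e * (1 - g))^-1).
  by apply: archi_boundP; rewrite invr_ge0 ltW.
exists n; rewrite ltNge; apply/negP => eg.
have n0 : 0 <= n%:R :> R by [].
have := key n; apply/negP; rewrite -ltNge.
have : 1 < n%:R * (e * (1 - g)) by rewrite -ltr_pdivrMr // mul1r.
move=> h; apply: (lt_le_trans h).
have : (1 + n%:R * (1 - g)) * e <= (1 + n%:R * (1 - g)) * g ^+ n.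
  by rewrite ler_wpM2l // addr_ge0 // mulr_ge0 // subr_ge0 ltW.
apply: le_trans; lra.
Qed.

Lemma limsup_le0_contraction (m : nat) (g : R) s t :
  (0 < m)%N -> 0 <= g -> g < 1 ->
  (forall k, s (k + m)%N <= g * s k + t k) ->
  limsup_le0 t -> limsup_le0 s.
Proof.
move=> m0 g0 g1 rec ht e e0.
have e2 : 0 < e / 2 by rewrite divr_gt0.
have [|K HK] := ht (e / 2 * (1 - g)); first by rewrite mulr_gt0 // subr_gt0.
(* [e / 2] is the fixed point of [x -> g x + e / 2 * (1 - g)], so subtracting it absorbs the
   perturbation and leaves a homogeneous inequality. *)
pose d k := s k - e / 2.
have dP k : (K <= k)%N -> d (k + m)%N <= g * d k.
  by move=> /HK tk; have := rec k; rewrite /d; lra.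
have dn j k : (K <= k)%N -> d (k + j * m)%N <= g ^+ j * d k.
  move=> Kk; elim: j => [|j IH]; first by rewrite mul0n addn0 mul1r.
  rewrite mulSn addnCA addnC exprS -mulrA.
  apply: le_trans (dP _ _) _; first by rewrite (leq_trans Kk) ?leq_addr.
  by rewrite ler_wpM2l.
(* Every index from [K] on is reached by steps of length [m] from one of [K, ..., K + m - 1], and
   [T] bounds [d] at all of these. Dividing by [T + 1] below avoids a zero divisor. *)
pose T := \sum_(i < m) `|d (K + i)%N|.
have T0 : 0 <= T by apply: sumr_ge0.
have [J HJ] : exists J, g ^+ J < e / 2 / (T + 1).
  by apply: exists_expr_lt => //; rewrite divr_gt0 // ltr_wpDl.
exists (K + J * m)%N => k Hk.
have Kk : (K <= k)%N by rewrite (leq_trans _ Hk) ?leq_addr.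
pose i := ((k - K) %% m)%N; pose j := ((k - K) %/ m)%N.
have kE : k = (K + i + j * m)%N.
  by rewrite -addnA [(i + _)%N]addnC -divn_eq subnKC.
have Jj : (J <= j)%N by rewrite leq_divRL // leq_subRL.
have im : (i < m)%N by rewrite ltn_mod.
have := dn j (K + i)%N (leq_addr _ _); rewrite -kE => dk.
have : d k < e / 2; last by rewrite /d; lra.
apply: le_lt_trans dk _.
have dT : d (K + i)%N <= T.
  rewrite /T (bigD1 (Ordinal im)) //= (le_trans (ler_norm _)) //.
  by rewrite lerDl sumr_ge0.
have gj : g ^+ j <= g ^+ J by rewrite ler_wiXn2l // ltW.
apply: (@le_lt_trans _ _ (g ^+ J * T)).
  apply: (@le_trans _ _ (g ^+ j * T)).
    by rewrite ler_wpM2l // exprn_ge0.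
  by rewrite ler_wpM2r.
rewrite ltr_pdivlMr ?ltr_wpDl // mulrDr mulr1 in HJ.
have := exprn_ge0 J g0; lra.
Qed.

End LimsupLe0.

Lemma normc_ge0 (R : realType) (l : R[i]) : 0 <= normc l.
Proof. by case: l => a b; rewrite /normc sqrtr_ge0. Qed.

Lemma normcX (R : realType) (l : R[i]) k : normc (l ^+ k) = normc l ^+ k.
Proof.
elim: k => [|k IH]; first by rewrite !expr0 normc1.
by rewrite !exprS normcM IH.
Qed.

(** * Recursions [X' = M X E + f], with rows measured by a seminorm [nu] *)

Section SpectralDecay.
Variables (R : realType) (N m : nat) (g : R).
Variables (nu : 'rV[R[i]]_N -> R) (E : 'M[R[i]]_N).
Hypothesis m_gt0 : (0 < m)%N.
Hypothesis g_ge0 : 0 <= g.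
Hypothesis nu_ge0 : forall y, 0 <= nu y.
Hypothesis nuD : forall y z, nu (y + z) <= nu y + nu z.
Hypothesis nuZ : forall c y, nu (c *: y) = normc c * nu y.
Hypothesis nu_nonexp : forall y, nu (y *m E) <= nu y.
Hypothesis nu_contract : forall y, nu (y *m E ^+ m) <= g * nu y.

(** Covers both regimes: for [g = 1], [m = 1] it means [normc l < 1], and for [g < 1] it already
    follows from [normc l <= 1]. *)
Let good (l : R[i]) := normc l <= 1 /\ g * normc l ^+ m < 1.

Lemma nu0 : nu 0 = 0.
Proof. by rewrite -(scale0r 0) nuZ normc0 mul0r. Qed.

(** The map [y -> l y E] does not increase [nu], so over [m] steps the forcing adds at most the sum
    of its seminorms, while the unforced part shrinks by the factor [g * normc l ^+ m < 1]. *)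
Lemma scalar_mode_decay (l : R[i]) (y f : nat -> 'rV[R[i]]_N) :
  good l -> (forall k, y k.+1 = l *: (y k *m E) + f k) ->
  limsup_le0 (fun k => nu (f k)) -> limsup_le0 (fun k => nu (y k)).
Proof.
move=> [l1 gl] rec hf.
have dev k t : nu (y (k + t)%N - l ^+ t *: (y k *m E ^+ t))
    <= \sum_(s < t) nu (f (k + s)%N).
  elim: t => [|t IH].
    by rewrite !expr0 scale1r mulmx1 addn0 subrr nu0 big_ord0.
  rewrite big_ord_recr /= addnS rec.
  have -> : l *: (y (k + t)%N *m E) + f (k + t)%N - l ^+ t.+1 *: (y k *m E ^+ t.+1)
    = l *: ((y (k + t)%N - l ^+ t *: (y k *m E ^+ t)) *m E) + f (k + t)%N.
    rewrite mulmxBl scalerBr -scalemxAl scalerA -exprS -mulmxA [E ^+ t.+1]exprSr.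
    by rewrite addrAC.
  apply: le_trans (nuD _ _) _; rewrite lerD2r nuZ.
  set z := _ - _ in IH *.
  apply: le_trans IH; apply: le_trans (nu_nonexp z).
  by rewrite ler_piMl.
apply: (@limsup_le0_contraction _ m (g * normc l ^+ m) _
         (fun k => \sum_(s < m) nu (f (k + s)%N))) => //.
- by rewrite mulr_ge0 // exprn_ge0 // normc_ge0.
- move=> k; have -> : y (k + m)%N = l ^+ m *: (y k *m E ^+ m)
      + (y (k + m)%N - l ^+ m *: (y k *m E ^+ m)) by rewrite addrC subrK.
  apply: le_trans (nuD _ _) _; apply: lerD => //.
  by rewrite nuZ normcX [g * _]mulrC -mulrA ler_wpM2l // exprn_ge0 // normc_ge0.
- by apply: limsup_le0_sum => s; apply: (limsup_le0_shift s hf).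
Qed.

Definition rows_vanish n (X : nat -> 'M[R[i]]_(n, N)) :=
  forall c, limsup_le0 (fun k => nu (row c (X k))).

Lemma rows_vanishM n n' (P : 'M_(n', n)) (X : nat -> 'M[R[i]]_(n, N)) :
  rows_vanish X -> rows_vanish (fun k => P *m X k).
Proof.
move=> hX c.
have sum_le (I : finType) (F : I -> 'rV_N) : nu (\sum_i F i) <= \sum_i nu (F i).
  elim/big_rec2: _ => [|i b a _ ab]; first by rewrite nu0.
  by rewrite (le_trans (nuD _ _)) // lerD2l.
apply: (limsup_le0_le (t := fun k => \sum_j normc (P c j) * nu (row j (X k)))).
  move=> k; rewrite row_mul mulmx_sum_row; apply: le_trans (sum_le _ _) _.
  by apply: ler_sum => j _; rewrite nuZ mxE.
by apply: limsup_le0_sum => j; apply: limsup_le0Z; [exact: normc_ge0|exact: hX].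
Qed.

(* Peeling off one eigenvalue l: Y = (M - l) X obeys the same recursion and is
   annihilated by the remaining factors, while X' = l X E + (Y E + f). *)
Lemma rows_vanish_annihilated n (M : 'M[R[i]]_n.+1) (s : seq R[i])
    (X f : nat -> 'M[R[i]]_(n.+1, N)) :
  {in s, forall l, good l} -> (forall k, X k.+1 = M *m X k *m E + f k) ->
  rows_vanish f ->
  (forall k, horner_mx M (\prod_(l <- s) ('X - l%:P)) *m X k = 0) ->
  rows_vanish X.
Proof.
elim: s X f => [|l s IH] X f gs rec hf ann.
  move=> c; apply: limsup_le0_le (@limsup_le0_cst0 R) => k.
  have := ann k; rewrite big_nil rmorph1 mul1mx => ->.
  by rewrite row0 nu0.
have hY : rows_vanish (fun k => (M - l%:M) *m X k).
  apply: (IH _ (fun k => (M - l%:M) *m f k)).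
  - by move=> l' l's; apply: gs; rewrite inE l's orbT.
  - move=> k; rewrite rec mulmxDr; congr (_ + _).
    by rewrite !mulmxA mulmxBl mulmxBr scalar_mxC.
  - exact: rows_vanishM.
  - move=> k; have := ann k.
    rewrite big_cons mulrC rmorphM /= rmorphB /= horner_mx_X horner_mx_C.
    by rewrite mulmxA.
move=> c.
apply: (scalar_mode_decay (l := l)
          (f := fun k => row c ((M - l%:M) *m X k) *m E + row c (f k))).
- by apply: gs; rewrite inE eqxx.
- move=> k; rewrite rec linearD /= addrA; congr (_ + _).
  rewrite row_mul scalemxAl -mulmxDl; congr (_ *m E).
  by rewrite mulmxBl mul_scalar_mx linearB linearZ /= addrC subrK.
- apply: limsup_le0_le (limsup_le0D (hY c) (hf c)) => k.
  by apply: le_trans (nuD _ _) _; rewrite lerD2r nu_nonexp.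
Qed.

(** The characteristic polynomial splits over [R[i]] and annihilates [M], so its roots can be peeled
    off one by one. *)
Lemma rows_vanish_spectral n (M : 'M[R[i]]_n) (X f : nat -> 'M[R[i]]_(n, N)) :
  (forall l, eigenvalue M l -> good l) ->
  (forall k, X k.+1 = M *m X k *m E + f k) -> rows_vanish f -> rows_vanish X.
Proof.
case: n M X f => [|n] M X f gM rec hf; first by move=> [].
have [s Es] := closed_field_poly_normal (char_poly M).
rewrite (monicP (char_poly_monic M)) scale1r in Es.
apply: (rows_vanish_annihilated (s := s) _ rec hf) => [l ls|k].
  by apply: gM; rewrite eigenvalue_root_char Es root_prod_XsubC.
by rewrite -Es Cayley_Hamilton mul0mx.
Qed.

End SpectralDecay.

(** * Closure properties of vanishing vector sequences *)

Section TendsToZero.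
Variable R : realType.

Lemma tends_to_zeroP p (f : nat -> 'cV[R]_p) :
  tends_to_zero f <-> forall l, limsup_le0 (fun k => `|f k l 0|).
Proof.
split=> [hf l e /hf[K HK]|hf e e0]; first by exists K => k /HK.
have [K HK] := fin_all_exists (fun l => hf l e e0).
exists (\max_l K l)%N => k Kk l; apply: HK.
by apply: leq_trans Kk; apply: leq_bigmax.
Qed.

Lemma tends_to_zero_ext p (f g : nat -> 'cV[R]_p) :
  (forall k, f k = g k) -> tends_to_zero g -> tends_to_zero f.
Proof.
by move=> fg hg e /hg[K HK]; exists K => k Kk l; rewrite fg; apply: HK.
Qed.

Lemma tends_to_zeroD p (f g : nat -> 'cV[R]_p) :
  tends_to_zero f -> tends_to_zero g -> tends_to_zero (fun k => f k + g k).
Proof.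
move=> /tends_to_zeroP hf /tends_to_zeroP hg; apply/tends_to_zeroP => l.
apply: limsup_le0_le (limsup_le0D (hf l) (hg l)) => k.
by rewrite mxE ler_normD.
Qed.

Lemma tends_to_zero_sum p (I : finType) (f : I -> nat -> 'cV[R]_p) :
  (forall i, tends_to_zero (f i)) -> tends_to_zero (fun k => \sum_i f i k).
Proof.
move=> hf; apply/tends_to_zeroP => l.
have hfl : limsup_le0 (fun k => \sum_i `|f i k l 0|).
  by apply: limsup_le0_sum => i; move/tends_to_zeroP: (hf i); apply.
by apply: limsup_le0_le hfl => k; rewrite summxE ler_norm_sum.
Qed.

Lemma tends_to_zeroM p q (M : 'M[R]_(q, p)) (f : nat -> 'cV[R]_p) :
  tends_to_zero f -> tends_to_zero (fun k => M *m f k).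
Proof.
move=> /tends_to_zeroP hf; apply/tends_to_zeroP => l.
apply: (@limsup_le0_le _ _ (fun k => \sum_j `|M l j| * `|f k j 0|)) => [k|].
  rewrite mxE (le_trans (ler_norm_sum _ _ _)) //.
  by apply: ler_sum => j _; rewrite normrM.
by apply: limsup_le0_sum => j; apply: limsup_le0Z.
Qed.

Lemma tends_to_zeroZ p (c : R) (f : nat -> 'cV[R]_p) :
  tends_to_zero f -> tends_to_zero (fun k => c *: f k).
Proof.
move=> hf; apply: tends_to_zero_ext (tends_to_zeroM c%:M hf) => k.
by rewrite mul_scalar_mx.
Qed.

Lemma tends_to_zeroB p (f g : nat -> 'cV[R]_p) :
  tends_to_zero f -> tends_to_zero g -> tends_to_zero (fun k => f k - g k).
Proof.
move=> hf hg; apply: tends_to_zero_ext (tends_to_zeroD hf (tends_to_zeroZ (-1) hg)) => k.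
by rewrite scaleN1r.
Qed.

Lemma tends_to_zero0 p : tends_to_zero (fun=> 0 : 'cV[R]_p).
Proof. by move=> e e0; exists 0%N => k _ l; rewrite mxE normr0. Qed.

End TendsToZero.

(** * Passage from real to complex matrices *)

Section Complexification.
Variable R : realType.

Lemma cmxM m n p (P : 'M[R]_(m, n)) (Q : 'M[R]_(n, p)) :
  cmx (P *m Q) = cmx P *m cmx Q.
Proof. exact: (map_mxM (real_complex R)). Qed.

Lemma cmxD m n (P Q : 'M[R]_(m, n)) : cmx (P + Q) = cmx P + cmx Q.
Proof. exact: (map_mxD (real_complex R)). Qed.

Lemma normc_real (x : R) : normc (x%:C)%C = `|x|.
Proof. by rewrite /normc /= expr0n addr0 sqrtr_sqr. Qed.

Lemma normc_normE (l : R[i]) : `|l| = ((normc l)%:C)%C.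
Proof. by []. Qed.

Lemma normcB_real (x y : R) : normc ((x%:C)%C - (y%:C)%C) = `|x - y|.
Proof. by rewrite -rmorphB normc_real. Qed.

Lemma normc_sum (I : finType) (F : I -> R[i]) :
  normc (\sum_i F i) <= \sum_i normc (F i).
Proof.
elim/big_rec2: _ => [|i b a _ ab]; first by rewrite normc0.
by rewrite (le_trans (le_normcD _ _)) // lerD2l.
Qed.

End Complexification.

(** The single-column case of the spectral lemma: [N], [m], [g] and [E] are all 1, and [nu] is the
    modulus of the only entry. *)
Lemma schur_stable_tends_to_zero (R : realType) n (A : 'M[R]_n)
    (x f : nat -> 'cV[R]_n) :
  schur_stable A -> (forall k, x k.+1 = A *m x k + f k) ->
  tends_to_zero f -> tends_to_zero x.
Proof.
move=> hA rec /tends_to_zeroP hf.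
have vanishP (y : nat -> 'cV[R]_n) c k :
    normc (row c (cmx (y k)) 0 0) = `|y k c 0|.
  by rewrite !mxE normc_real.
have hX : rows_vanish (fun y : 'rV[R[i]]_1 => normc (y 0 0)) (fun k => cmx (x k)).
  refine (@rows_vanish_spectral R 1 1 1 (fun y => normc (y 0 0)) 1 _ _ _ _ _ _ _ n
    (cmx A) (fun k => cmx (x k)) (fun k => cmx (f k)) _ _ _) => //.
  - by move=> y; apply: normc_ge0.
  - by move=> y z; rewrite mxE; apply: le_normcD.
  - by move=> c y; rewrite mxE normcM.
  - by move=> y; rewrite mulmx1.
  - by move=> y; rewrite expr1 mulmx1 mul1r.
  - move=> l /hA; rewrite normc_normE -[1]/((1%:C)%C) ltcR mul1r expr1 => l1.
    by split => //; apply: ltW.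
  - by move=> k; rewrite rec cmxD cmxM mulmx1.
  - move=> c; apply: limsup_le0_le (hf c) => k.
    by rewrite vanishP.
apply/tends_to_zeroP => c; apply: limsup_le0_le (hX c) => k.
by rewrite vanishP.
Qed.

(** * The spread seminorm and its contraction by stochastic matrices *)

Section Spread.
Variables (R : realType) (N : nat).

Implicit Types y z : 'rV[R[i]]_N.

(** The diameter of the set of entries in the complex plane. It is a seminorm that vanishes exactly
    on constant rows, hence measures disagreement. *)
Definition spread (y : 'rV[R[i]]_N) : R :=
  \big[Num.max/0]_(e : 'I_N * 'I_N) normc (y 0 e.1 - y 0 e.2).

Lemma spread_ge0 y : 0 <= spread y.
Proof. exact: bigmax_ge_id. Qed.

Lemma le_spread y i j : normc (y 0 i - y 0 j) <= spread y.
Proof. exact: (le_bigmax _ (fun e : 'I_N * 'I_N => normc (y 0 e.1 - y 0 e.2)) (i, j)). Qed.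

Lemma spread_le y b :
  0 <= b -> (forall i j, normc (y 0 i - y 0 j) <= b) -> spread y <= b.
Proof. by move=> b0 yb; apply: bigmax_le => // -[i j] _; apply: yb. Qed.

Lemma spreadD y z : spread (y + z) <= spread y + spread z.
Proof.
apply: spread_le => [|i j]; first by rewrite addr_ge0 ?spread_ge0.
rewrite !mxE opprD addrACA (le_trans (le_normcD _ _)) //.
by rewrite lerD ?le_spread.
Qed.

Lemma spreadZ c y : spread (c *: y) = normc c * spread y.
Proof.
have le_Z (a : R[i]) z : spread (a *: z) <= normc a * spread z.
  apply: spread_le => [|i j]; first by rewrite mulr_ge0 ?normc_ge0 ?spread_ge0.
  by rewrite !mxE -mulrBr normcM ler_wpM2l ?normc_ge0 ?le_spread.
apply/le_anti; rewrite le_Z /=.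
have [->|c0] := eqVneq c 0; first by rewrite normc0 mul0r spread_ge0.
(* The reverse inequality is the direct one applied to the inverse scalar. *)
have := le_Z c^-1 (c *: y); rewrite scalerA mulVf // scale1r normcV.
have nc : 0 < normc c.
  by rewrite lt_neqAle normc_ge0 andbT eq_sym; apply: contra_neq c0 => /eq0_normc.
by rewrite [_^-1 * _]mulrC ler_pdivlMr // mulrC.
Qed.

Definition row_stochastic (P : 'M[R]_N) :=
  (forall i j, 0 <= P i j) /\ (forall i, \sum_j P i j = 1).

Lemma row_stochasticX P k : row_stochastic P -> row_stochastic (P ^+ k).
Proof.
move=> [P0 P1]; elim: k => [|k [IH0 IH1]].
  split=> [i j|i]; first by rewrite expr0 mxE; case: eqP.
  rewrite (bigD1 i) //= big1 ?addr0 => [|j ji]; first by rewrite expr0 mxE eqxx.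
  by rewrite expr0 mxE eq_sym (negPf ji).
split=> [i j|i].
  by rewrite exprS mxE sumr_ge0 // => t _; rewrite mulr_ge0.
under eq_bigr do rewrite exprS mxE.
rewrite exchange_big /= -[RHS](P1 i); apply: eq_bigr => t _.
by rewrite -mulr_sumr IH1 mulr1.
Qed.

(* (Py)_i - (Py)_j is the average of y_t - y_s over independent draws of t and s
   from rows i and j of P; the event t = s = r contributes nothing. *)
Lemma spread_doeblin (P : 'M[R]_N) (r : 'I_N) (b : R) (y : 'rV[R[i]]_N) :
  row_stochastic P -> (forall i j, 1 - P i r * P j r <= b) ->
  spread (y *m cmx P^T) <= b * spread y.
Proof.
move=> [P0 P1] Pb.
have b0 : 0 <= b.
  apply: le_trans (Pb r r).
  have : P r r <= 1 by rewrite -(P1 r) (bigD1 r) //= lerDl sumr_ge0.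
  by move=> Pr; rewrite subr_ge0 mulr_ile1.
apply: spread_le => [|i j]; first by rewrite mulr_ge0 ?spread_ge0.
pose w (e : 'I_N * 'I_N) := P i e.1 * P j e.2.
have w0 e : 0 <= w e by rewrite mulr_ge0.
have w1 : \sum_e w e = 1.
  rewrite -(pair_bigA _ (fun t s => P i t * P j s)) /= -[RHS](P1 i).
  by apply: eq_bigr => t _; rewrite -mulr_sumr P1 mulr1.
have C1 (h : 'I_N) : \sum_t ((P h t)%:C)%C = 1 :> R[i].
  by rewrite -rmorph_sum P1.
have -> : (y *m cmx P^T) 0 i - (y *m cmx P^T) 0 j
    = \sum_e ((w e)%:C)%C * (y 0 e.1 - y 0 e.2).
  under [RHS]eq_bigr do rewrite mulrBr.
  rewrite sumrB; congr (_ - _).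
    rewrite -(pair_bigA _ (fun t s => ((P i t * P j s)%:C)%C * y 0 t)) mxE /=.
    apply: eq_bigr => t _; rewrite -mulr_suml; under eq_bigr do rewrite rmorphM.
    by rewrite -mulr_sumr C1 mulr1 mulrC !mxE.
  rewrite -(pair_bigA _ (fun t s => ((P i t * P j s)%:C)%C * y 0 s)) exchange_big mxE /=.
  apply: eq_bigr => t _; rewrite -mulr_suml; under eq_bigr do rewrite rmorphM.
  by rewrite -mulr_suml C1 mul1r mulrC !mxE.
apply: le_trans (normc_sum _) _.
rewrite (bigD1 (r, r)) //= subrr mulr0 normc0 add0r.
apply: (@le_trans _ _ ((1 - w (r, r)) * spread y)).
  rewrite -w1 [X in X - _](bigD1 (r, r)) //= addrAC subrr add0r mulr_suml.
  apply: ler_sum => e _; rewrite normcM normc_real ger0_norm //.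
  by rewrite ler_wpM2l ?le_spread.
by rewrite ler_wpM2r ?spread_ge0 ?Pb.
Qed.

End Spread.

(** The spectral lemma with [nu] the spread and [E] the transpose of [D]: the positive column of
    [D ^+ m] gives a contraction factor below 1, which suffices for eigenvalues of modulus at most
    1. *)
Lemma consensus_tends_to_zero (R : realType) (N n m : nat) (r : 'I_N)
    (D : 'M[R]_N) (A : 'M[R]_n) (x f : 'I_N -> nat -> 'cV[R]_n) :
  row_stochastic D -> (0 < m)%N -> (forall i, 0 < (D ^+ m) i r) ->
  eig_closed_disc A ->
  (forall i k, x i k.+1 = A *m (\sum_j D i j *: x j k) + f i k) ->
  (forall i, tends_to_zero (f i)) ->
  forall i j, tends_to_zero (fun k => x i k - x j k).
Proof.
move=> hD m0 Dr hA rec hf i j.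
(* Agents become columns, so row [c] collects coordinate [c] of all agents and [D] acts from the
   right as its transpose. *)
pose stack (y : 'I_N -> nat -> 'cV[R]_n) k : 'M[R]_(n, N) :=
  \matrix_(c, h) y h k c 0.
(* The worst Doeblin coefficient over all pairs of rows. As a maximum of finitely many numbers below
   1, with default 0, it lies in [[0, 1)]. *)
pose b := \big[Num.max/0]_(e : 'I_N * 'I_N) (1 - (D ^+ m) e.1 r * (D ^+ m) e.2 r).
have b0 : 0 <= b by exact: bigmax_ge_id.
have b1 : b < 1.
  by apply: bigmax_lt => // e _; rewrite ltrBlDr ltrDl mulr_gt0.
have ED k : (cmx D^T) ^+ k = cmx (D ^+ k)^T.
  elim: k => [|k IH]; first by rewrite !expr0 trmx1 /cmx (map_mx1 (real_complex R)).
  by rewrite exprS IH [D ^+ k.+1]exprSr trmx_mul cmxM.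
have hX : rows_vanish (@spread R N) (fun k => cmx (stack x k)).
  refine (@rows_vanish_spectral R N m b (@spread R N) (cmx D^T) _ _ _ _ _ _ _ n
    (cmx A) (fun k => cmx (stack x k)) (fun k => cmx (stack f k)) _ _ _) => //.
  - exact: spread_ge0.
  - exact: spreadD.
  - exact: spreadZ.
  (* Nonexpansiveness is the Doeblin estimate with constant 1. *)
  - move=> y; rewrite -[leRHS]mul1r; apply: (spread_doeblin (r := r)) => // h h'.
    by rewrite lerBlDr lerDl mulr_ge0 //; case: hD.
  - move=> y; rewrite ED; apply: (spread_doeblin (r := r)).
      exact: row_stochasticX.
    move=> h h'; exact: (le_bigmax _ (fun e : 'I_N * 'I_N =>
      1 - (D ^+ m) e.1 r * (D ^+ m) e.2 r) (h, h')).
  - move=> l /hA; rewrite normc_normE -[1]/((1%:C)%C) lecR => l1; split => //.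
    by rewrite (le_lt_trans _ b1) // ler_piMr // exprn_ile1 // normc_ge0.
  - move=> k; rewrite -!cmxM -cmxD; congr cmx; apply/matrixP => c h.
    rewrite -mulmxA !mxE rec !mxE; congr (_ + _); apply: eq_bigr => d _.
    rewrite mxE summxE; congr (_ * _); apply: eq_bigr => h' _.
    by rewrite !mxE mulrC.
  - move=> c; apply: (@limsup_le0_le _ _
      (fun k => \sum_h `|f h k c 0| + \sum_h `|f h k c 0|)) => [k|].
      apply: spread_le => [|h h']; first by rewrite addr_ge0 ?sumr_ge0.
      rewrite !mxE normcB_real (le_trans (ler_normB _ _)) //.
      by apply: lerD; [rewrite (bigD1 h)|rewrite (bigD1 h')] => //=;
      rewrite lerDl sumr_ge0.
    by apply: limsup_le0D; apply: limsup_le0_sum => h;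
      move/tends_to_zeroP: (hf h); apply.
apply/tends_to_zeroP => c; apply: limsup_le0_le (hX c) => k.
have := le_spread (row c (cmx (stack x k))) i j.
by rewrite !mxE normcB_real.
Qed.

(** * Weights of the graph and positivity of a column of a power *)

Section Graph.
Variables (R : realType) (N : nat) (a : 'M[R]_N).
Hypothesis ha : adjacency a.

Let D : 'M[R]_N := \matrix_(i, j) dcoef a i j.

Let in_degree_gt0 i : 0 < 1 + in_degree a i.
Proof. by rewrite ltr_wpDr // sumr_ge0 // => j _; case: ha. Qed.

Lemma dcoef_stochastic : row_stochastic D.
Proof.
have d0 := in_degree_gt0; case: ha => a0 aii; split=> [i j|i].
  by rewrite mxE /dcoef; case: eqP => _; rewrite divr_ge0 // ltW.
under eq_bigr do rewrite mxE.
rewrite (bigD1 i) //= {1}/dcoef eqxx.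
have -> : \sum_(j | j != i) dcoef a i j = in_degree a i / (1 + in_degree a i).
  rewrite mulr_suml [RHS](bigD1 i) //= aii mul0r add0r.
  by apply: eq_bigr => j; rewrite /dcoef eq_sym => /negPf->.
by rewrite -mulrDl divff // gt_eqF.
Qed.

(** Following parents leads from each node to the root along positive weights. The positive diagonal
    entry at the root pads all these walks to one common length. *)
Lemma dcoef_power_positive_column :
  has_spanning_tree a ->
  exists m (r : 'I_N), (0 < m)%N /\ forall i, 0 < (D ^+ m) i r.
Proof.
move=> [r [par [par_gt0 par_r]]].
have [D0 _] := dcoef_stochastic.
have Dii i : 0 < D i i by rewrite mxE /dcoef eqxx divr_gt0.
have Dpar i : i != r -> 0 < D i (par i).
  by move=> /par_gt0 ap; rewrite mxE /dcoef; case: eqP => _; rewrite divr_gt0.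
have DX0 k i j : 0 <= (D ^+ k) i j.
  by case: (row_stochasticX k dcoef_stochastic).
have step k i t : 0 < D i t -> 0 < (D ^+ k) t r -> 0 < (D ^+ k.+1) i r.
  move=> Dit Dtr; rewrite exprS mxE (bigD1 t) //=.
  by rewrite ltr_wpDr ?mulr_gt0 // sumr_ge0 // => s _; rewrite mulr_ge0.
have reach m : forall k i, (k <= m)%N -> iter k par i = r -> 0 < (D ^+ m) i r.
  elim: m => [|m IH] k i.
    by rewrite leqn0 => /eqP-> /= ->; rewrite expr0 mxE eqxx.
  (* At the root the walk spends a step on the self-loop and continues with the empty parent
     path. *)
  have [->|ir] := eqVneq i r; first by move=> _ _; apply: (step _ _ r) => //; apply: (IH 0%N).
  case: k => [_ /= ir'|k km]; first by rewrite ir' eqxx in ir.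
  by rewrite iterSr => kr; apply: (step _ _ (par i)); [exact: Dpar|exact: (IH k)].
have [K HK] := fin_all_exists par_r.
(* The successor ensures a positive exponent. *)
exists (\max_i K i).+1, r; split => // i.
apply: (reach _ (K i)) => //; apply: leqW.
exact: (leq_bigmax i).
Qed.

End Graph.

(** * The closed loop of agents and protocol *)

Ltac mxring := apply/matrixP => ? ?; rewrite !mxE; ring.

Theorem theorem3
  (R : realType) (N : nat) (hN : (2 <= N)%N)
  (* agents: x_i(k+1) = A_i x_i + B_i u_i, y_i = C_i x_i, z_i = C^m_i x_i *)
  (p : nat) (n m r : 'I_N -> nat)
  (Ai : forall i, 'M[R]_(n i)) (Bi : forall i, 'M[R]_(n i, m i))
  (Ci : forall i, 'M[R]_(p, n i)) (Cmi : forall i, 'M[R]_(r i, n i))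
  (hstab : forall i, stabilizable (Ai i) (Bi i))
  (hdet : forall i, detectable (Ci i) (Ai i))
  (hrinv : forall i, right_invertible (Ci i) (Ai i) (Bi i))
  (hdetm : forall i, detectable (Cmi i) (Ai i))
  (* the target triple (C, A, B) *)
  (nx nq : nat) (A : 'M[R]_nx) (B : 'M[R]_(nx, p)) (C : 'M[R]_(p, nx))
  (hrankC : \rank C = p)
  (hinv : invertible C A B)
  (hunif : uniform_rank C A B nq)
  (hnq : forall i, max_inf_zero_order_le (Ci i) (Ai i) (Bi i) nq)
  (hzeros : no_invariant_zeros C A B)
  (hdisc : eig_closed_disc A)
  (* pre-compensators and the exosystems of the resulting disturbances *)
  (q s : 'I_N -> nat)
  (Ah : forall i, 'M[R]_(q i)) (Bh : forall i, 'M[R]_(q i, r i))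
  (Eh : forall i, 'M[R]_(q i, p)) (Ch : forall i, 'M[R]_(m i, q i))
  (Dh : forall i, 'M[R]_(m i, p))
  (As : forall i, 'M[R]_(s i)) (Cs : forall i, 'M[R]_(p, s i))
  (hAs : forall i, schur_stable (As i))
  (hprecomp : forall i (x : nat -> 'cV[R]_(n i)) (xi : nat -> 'cV[R]_(q i))
      (u : nat -> 'cV[R]_(m i)) (v : nat -> 'cV[R]_p),
      (forall k, x k.+1 = Ai i *m x k + Bi i *m u k) ->
      (forall k, xi k.+1 = Ah i *m xi k + Bh i *m (Cmi i *m x k) + Eh i *m v k) ->
      (forall k, u k = Ch i *m xi k + Dh i *m v k) ->
      exists (xb : nat -> 'cV[R]_nx) (w : nat -> 'cV[R]_(s i)),
        (forall k, xb k.+1 = A *m xb k + B *m (v k + Cs i *m w k)) /\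
        (forall k, w k.+1 = As i *m w k) /\
        (forall k, Ci i *m x k = C *m xb k))
  (* protocol gains *)
  (K : 'M[R]_(p, nx)) (H : 'M[R]_(nx, p))
  (hK : schur_stable (A - B *m K)) (hH : schur_stable (A - H *m C)) :
  forall a : 'M[R]_N, adjacency a -> has_spanning_tree a ->
  forall (x : forall i, nat -> 'cV[R]_(n i)) (xi : forall i, nat -> 'cV[R]_(q i))
         (xh : 'I_N -> nat -> 'cV[R]_nx) (eta : 'I_N -> nat -> 'cV[R]_nx)
         (u : forall i, nat -> 'cV[R]_(m i)),
  (forall i k, x i k.+1 = Ai i *m x i k + Bi i *m u i k) ->
  (forall i k, xi i k.+1 = Ah i *m xi i k + Bh i *m (Cmi i *m x i k)
                           - Eh i *m (K *m eta i k)) ->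
  (forall i k, xh i k.+1 = A *m xh i k
       - B *m (K *m (\sum_j dcoef a i j *: (eta i k - eta j k)))
       + H *m ((\sum_j dcoef a i j *: (Ci i *m x i k - Ci j *m x j k))
               - C *m xh i k)) ->
  (forall i k, eta i k.+1 = (A - B *m K) *m eta i k + A *m xh i k
       - A *m (\sum_j dcoef a i j *: (eta i k - eta j k))) ->
  (forall i k, u i k = Ch i *m xi i k - Dh i *m (K *m eta i k)) ->
  forall i j, tends_to_zero (fun k => Ci i *m x i k - Ci j *m x j k).
Proof.
move=> a ha htree x xi xh eta u hx hxi hxh heta hu i0 j0.
(* The protocol drives each pre-compensator with [v = - K eta], so every agent follows the target
   model with a disturbance [Cs w]. *)
have /fin_all_exists[xb /fin_all_exists[w hxw]] : forall i,
    exists (xb : nat -> 'cV[R]_nx) (w : nat -> 'cV[R]_(s i)),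
      (forall k, xb k.+1 = A *m xb k + B *m (- (K *m eta i k) + Cs i *m w k)) /\
      (forall k, w k.+1 = As i *m w k) /\ (forall k, Ci i *m x i k = C *m xb k).
  move=> i; apply: (hprecomp i (x i) (xi i) (u i)) => k.
  - exact: hx.
  - by rewrite hxi mulmxN.
  - by rewrite hu mulmxN.
have hxb i k : xb i k.+1 = A *m xb i k + B *m (- (K *m eta i k) + Cs i *m w i k).
  by have [] := hxw i.
have hy i k : Ci i *m x i k = C *m xb i k by have [_ []] := hxw i.
have hw i : tends_to_zero (w i).
  apply: (schur_stable_tends_to_zero (hAs i) _ (@tends_to_zero0 R (s i))) => k.
  by have [_ [-> _]] := hxw i; rewrite addr0.
(* The action of [I - D] on network signals, by unit row sums ([LD]). It sees only differences, so
   it sends synchronized signals to vanishing ones ([Lsmall]). *)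
pose L (z : 'I_N -> nat -> 'cV[R]_nx) i k := \sum_j dcoef a i j *: (z i k - z j k).
have LB z z' i k : L (fun i k => z i k - z' i k) i k = L z i k - L z' i k.
  rewrite /L -sumrB; apply: eq_bigr => j _.
  by rewrite -scalerBr; congr (_ *: _); mxring.
have LM (M : 'M_nx) z i k : L (fun i k => M *m z i k) i k = M *m L z i k.
  rewrite /L mulmx_sumr; apply: eq_bigr => j _.
  by rewrite -scalemxAr mulmxBr.
have Lsmall z i : (forall j j', tends_to_zero (fun k => z j k - z j' k)) ->
    tends_to_zero (L z i).
  by move=> hz; apply: tends_to_zero_sum => j; apply: tends_to_zeroZ.
pose D : 'M[R]_N := \matrix_(i, j) dcoef a i j.
have [D0 D1] : row_stochastic D := dcoef_stochastic ha.
have LD z i k : \sum_j D i j *: z j k = z i k - L z i k.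
  rewrite /L; under [X in _ - X]eq_bigr do rewrite scalerBr.
  rewrite sumrB -scaler_suml.
  have -> : \sum_j dcoef a i j = 1.
    by rewrite -[RHS](D1 i); apply: eq_bigr => j _; rewrite mxE.
  rewrite scale1r opprB addrC subrK; apply: eq_bigr => j _; rewrite mxE //.
pose d i k := B *m (Cs i *m w i k).
have hd i : tends_to_zero (d i) by do 2!apply: tends_to_zeroM.
pose e i k := L xb i k - xh i k.
have he i : tends_to_zero (e i).
  (* The terms in [B K (L eta)] cancel between [L xb] and [xh], leaving [e' = (A - H C) e + L d]. *)
  apply: (schur_stable_tends_to_zero (f := L d i) hH); last first.
    by apply: Lsmall => j j'; apply: tends_to_zeroB.
  move=> k; rewrite /e hxh -/(L eta i k).
  have -> : \sum_j dcoef a i j *: (Ci i *m x i k - Ci j *m x j k) = C *m L xb i k.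
    rewrite mulmx_sumr; apply: eq_bigr => j _.
    by rewrite !hy -mulmxBr scalemxAr.
  have -> : L xb i k.+1 = A *m L xb i k - B *m (K *m L eta i k) + L d i k.
    rewrite !mulmxA -!LM -LB /L -big_split; apply: eq_bigr => j _ /=.
    rewrite -scalerDr !hxb !mulmxDr !mulmxN /d -!mulmxA; congr (_ *: _).
    by mxring.
  rewrite !mulmxBr !mulmxBl -!mulmxA; mxring.
pose del i k := xb i k - eta i k.
(* The terms [B K eta] cancel, and substituting [xh = L xb - e] turns the coupling into
   [- A (L del) + A e]. *)
have hdel i k : del i k.+1 = A *m (\sum_j D i j *: del j k) + (A *m e i k + d i k).
  rewrite LD /del hxb heta -/(L eta i k) LB /e /d.
  rewrite !(mulmxDr, mulmxDl, mulmxN, mulNmx) -!mulmxA; mxring.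
have hdiff j j' : tends_to_zero (fun k => del j k - del j' k).
  have [m0 [r0 [m0_gt0 Dr]]] := dcoef_power_positive_column ha htree.
  apply: (consensus_tends_to_zero (conj D0 D1) m0_gt0 Dr hdisc hdel) => i.
  by apply: tends_to_zeroD => //; apply: tends_to_zeroM.
have heta0 i : tends_to_zero (eta i).
  (* The input [A (xh - L eta)] equals [A (L del - e)], which vanishes because the [del]
     synchronize. *)
  apply: (schur_stable_tends_to_zero (f := fun k => A *m (L del i k - e i k)) hK).
    move=> k; rewrite heta -/(L eta i k) -addrA -mulmxBr LB /e; congr (_ + A *m _).
    by mxring.
  apply/tends_to_zeroM/tends_to_zeroB => //; exact: Lsmall.
apply: (tends_to_zero_ext
  (g := fun k => C *m ((del i0 k - del j0 k) + (eta i0 k - eta j0 k)))) => [k|].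
  by rewrite !hy -mulmxBr /del; congr (C *m _); mxring.
by apply/tends_to_zeroM/tends_to_zeroD => //; apply: tends_to_zeroB.
Qed.
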